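(* Let $d\ge 1$, let $A=K[(a_{ij})_{1\le i,j\le d}]$ be the polynomial ring in $d^2$ indeterminates over $K$, and let $G=(a_{ij})_{1\le i,j\le d}$ be the generic $d\times d$ matrix with coefficients in $A$. Let $x\in K^d\setminus\{0\}$, and let $\varphi$ be the $\sigma$-semi-linear map on $A^d$ whose matrix in the canonical basis is $G$. Then there exists a unique family of polynomials $P_0,\dots,P_{d-1}\in A$, depending only on $x$, such that $$\varphi^d(x)=P_{d-1}\varphi^{d-1}(x)+\cdots+P_1\varphi(x)+P_0x.$$ Moreover, each $P_i$ is a homogeneous polynomial in the coefficients $a_{ij}$ of $G$.
   Context: $K$ is a field of characteristic $p>0$, $a\ge1$ an integer, $q=p^a$, with $\mathbb{F}_q\subset K$, and $\sigma$ is the $q$-th power Frobenius map $y\mapsto y^q$, acting on $K$, on $A$, and coordinatewise on vectors of $A^d$. The $\sigma$-semi-linear map with matrix $G$ is $\varphi(y)=G\,\sigma(y)$ for column vectors $y\in A^d$; it is additive and satisfies $\varphi(\lambda y)=\sigma(\lambda)\varphi(y)$ for $\lambda\in A$. *)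

(* Defs.v *)
From HB Require Import structures.
From mathcomp Require Export all_boot all_order all_algebra.
From mathcomp.multinomials Require Export mpoly.

Set Implicit Arguments.
Unset Strict Implicit.
Unset Printing Implicit Defensive.

Import GRing.Theory.
Local Open Scope ring_scope.

(* The exponent q is a parameter; this is a ring endomorphism only when q is
   a power of the characteristic. *)
Definition frob (q : nat) (R : comNzRingType) (y : R) : R := y ^+ q.

Definition semilinear_map (q : nat) (R : comNzRingType) (d : nat)
    (G : 'M[R]_d) (y : 'cV[R]_d) : 'cV[R]_d :=
  G *m map_mx (@frob q R) y.

(* The d * d indeterminates are indexed by 'I_(d * d); mxvec_index is the
   row-major bijection from pairs (i, j) onto this index set. *)
Definition generic_mx (K : fieldType) (d : nat) : 'M[{mpoly K[d * d]}]_d :=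
  \matrix_(i < d, j < d) 'X_(mxvec_index i j).

Definition const_vec (K : fieldType) (d : nat) (x : 'cV[K]_d) :
    'cV[{mpoly K[d * d]}]_d :=
  map_mx (@mpolyC (d * d) K) x.

(* Main.v *)
From HB Require Import structures.
Require Import Defs.
From mathcomp Require Import all_boot all_order all_algebra.
From mathcomp.multinomials Require Import mpoly.

Set Implicit Arguments.
Unset Strict Implicit.
Unset Printing Implicit Defensive.

Import GRing.Theory.
Local Open Scope ring_scope.

(** Put v_i := phi^i(x).  Over every integral domain of characteristic p, v_d lies
    in the span of v_0, ..., v_(d-1); the proof is by induction on d.  Projecting
    along x, and clearing the denominator x_k, the vectors v_1, v_2, ... become, up
    to a unitriangular change, the iterates of a semilinear map in dimension d - 1;
    so x_k^N v_d lies in the span, for every coordinate k.  After a deformation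
    making two coordinates x_0, x_1 of x a regular sequence and v_0, ..., v_(d-1)
    independent, the relations with denominators x_0^N and x_1^N' must coincide,
    hence have no denominator; then specialize back.
    For the generic matrix, v_0, ..., v_(d-1) are independent because some matrix
    over K has x as a cyclic vector, whence uniqueness, and each v_i is
    homogeneous, so the P_i may be replaced by suitable homogeneous components. *)

(** * Frobenius powers and semilinear maps *)

Section FrobeniusPower.

Variables (R : comNzRingType) (p a : nat).
Hypothesis charRp : p \in [pchar R].

(* An alias carrying the characteristic hypothesis, so that it can be
   declared a ring morphism. *)
Definition frob_pow of p \in [pchar R] := @frob (p ^ a) R.

Local Notation sigma := (frob_pow charRp).

Lemma frob_pow_zmod_morphism : zmod_morphism sigma.
Proof.
move=> y z; rewrite /frob_pow /frob.
have pn : [pchar R].-nat (p ^ a)%N.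
  by rewrite pnatX pnatE ?charRp // (pcharf_prime charRp).
by rewrite exprDn_pchar // exprNn_pchar.
Qed.

Lemma frob_pow_monoid_morphism : monoid_morphism sigma.
Proof. by split=> [|y z]; rewrite /frob_pow /frob ?expr1n ?exprMn. Qed.

HB.instance Definition _ :=
  GRing.isZmodMorphism.Build R R sigma frob_pow_zmod_morphism.
HB.instance Definition _ :=
  GRing.isMonoidMorphism.Build R R sigma frob_pow_monoid_morphism.

Variables (d : nat) (G : 'M[R]_d).
Local Notation phi := (semilinear_map (p ^ a) G).

Lemma semilinear_mapE y : phi y = G *m map_mx sigma y.
Proof. by []. Qed.

Lemma semilinear_mapD y z : phi (y + z) = phi y + phi z.
Proof. by rewrite !semilinear_mapE map_mxD mulmxDr. Qed.

Lemma semilinear_mapB y z : phi (y - z) = phi y - phi z.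
Proof. by rewrite !semilinear_mapE map_mxB mulmxBr. Qed.

Lemma semilinear_mapZ c y : phi (c *: y) = (c ^+ (p ^ a)) *: phi y.
Proof. by rewrite !semilinear_mapE map_mxZ scalemxAr. Qed.

Lemma semilinear_map_sum n (c : nat -> R) (v : nat -> 'cV[R]_d) :
  phi (\sum_(i < n) c i *: v i) = \sum_(i < n) c i ^+ (p ^ a) *: phi (v i).
Proof.
elim: n => [|n IHn]; first by rewrite !big_ord0 semilinear_mapE map_mx0 mulmx0.
by rewrite !big_ord_recr semilinear_mapD semilinear_mapZ IHn.
Qed.

End FrobeniusPower.

Lemma map_iter_semilinear (R S : comNzRingType) (h : {rmorphism R -> S})
    (q d n : nat) (G : 'M[R]_d) (y : 'cV[R]_d) :
  map_mx h (iter n (semilinear_map q G) y) =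
  iter n (semilinear_map q (map_mx h G)) (map_mx h y).
Proof.
elim: n => //= n <-; rewrite /semilinear_map map_mxM -!map_mx_comp.
by congr (_ *m _); apply/matrixP=> i j; rewrite !mxE /= /frob rmorphXn.
Qed.

(** * Spans of initial segments of a sequence *)

Section Span.

Variables (R : comNzRingType) (V : lmodType R).
Implicit Types (v w : nat -> V) (y z : V).

Definition in_span v n y := exists c : nat -> R, y = \sum_(i < n) c i *: v i.

Lemma in_spanD v n y z : in_span v n y -> in_span v n z -> in_span v n (y + z).
Proof.
move=> [b ->] [c ->]; exists (fun i => b i + c i).
by rewrite -big_split; apply: eq_bigr => i _; rewrite scalerDl.
Qed.

Lemma in_spanZ v n k y : in_span v n y -> in_span v n (k *: y).
Proof.
move=> [c ->]; exists (fun i => k * c i).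
by rewrite scaler_sumr; apply: eq_bigr => i _; rewrite scalerA.
Qed.

Lemma in_spanB v n y z : in_span v n y -> in_span v n z -> in_span v n (y - z).
Proof. by move=> vy vz; rewrite -scaleN1r; apply/in_spanD/in_spanZ. Qed.

Lemma in_span0 v n : in_span v n 0.
Proof. by exists (fun=> 0); rewrite big1 // => i _; rewrite scale0r. Qed.

Lemma in_span_sum v n m (c : nat -> R) w :
  (forall i, (i < m)%N -> in_span v n (w i)) ->
  in_span v n (\sum_(i < m) c i *: w i).
Proof.
move=> vw; apply: (big_ind (in_span v n)) => [|y z|i _].
- exact: in_span0.
- exact: in_spanD.
- exact/in_spanZ/vw.
Qed.

Lemma in_span_gen v n i : (i < n)%N -> in_span v n (v i).
Proof.
move=> ltin; exists (fun j => (j == i)%:R).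
rewrite (bigD1 (Ordinal ltin)) //= eqxx scale1r big1 ?addr0 // => j.
by rewrite -val_eqE /= => /negPf ->; rewrite scale0r.
Qed.

Lemma in_span_trans v w m n y :
  (forall i, (i < m)%N -> in_span v n (w i)) -> in_span w m y -> in_span v n y.
Proof. by move=> vw [c ->]; apply: in_span_sum. Qed.

Lemma in_span_widen v m n y : (m <= n)%N -> in_span v m y -> in_span v n y.
Proof.
move=> lemn; apply: in_span_trans => i ltim.
exact/in_span_gen/(leq_trans ltim).
Qed.

End Span.

(** * Projection along a vector, with its denominator cleared *)

Section ProjectionAlong.

Variables (R : comNzRingType) (e : nat) (k : 'I_e.+1) (x : 'cV[R]_e.+1).

(* x_k times the projection parallel to x onto the coordinates other than k. *)
Definition proj_along : 'M[R]_(e, e.+1) :=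
  x k 0 *: row' k 1%:M - row' k x *m delta_mx 0 k.

Lemma proj_alongE (y : 'cV[R]_e.+1) :
  proj_along *m y = x k 0 *: row' k y - y k 0 *: row' k x.
Proof.
rewrite mulmxBl -scalemxAl -mulmxA -rowE.
have -> : row' k (1%:M : 'M[R]_e.+1) *m y = row' k y.
  rewrite -[in RHS](mul1mx y); apply/matrixP => i j; rewrite !mxE.
  by apply: eq_bigr => l _; rewrite !mxE.
congr (_ - _); apply/matrixP => i j.
by rewrite !mxE big_ord1 !mxE !ord1 mulrC.
Qed.

Lemma proj_along_decomp (y : 'cV[R]_e.+1) :
  x k 0 *: y = y k 0 *: x + col' k 1%:M *m (proj_along *m y).
Proof.
rewrite proj_alongE; apply/matrixP => i j; rewrite ord1 {j} !mxE.
case: (unliftP k i) => [j ->|->].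
  rewrite (bigD1 j) //= !mxE eqxx mul1r big1 ?addr0 => [|l ne_lj].
    by rewrite addrC subrK.
  by rewrite !mxE (inj_eq lift_inj) eq_sym (negPf ne_lj) mul0r.
rewrite big1 ?addr0 1?mulrC // => l _.
by rewrite !mxE (negPf (neq_lift k l)) mul0r.
Qed.

End ProjectionAlong.

(** * The linear relation over domains of characteristic p *)

Section Relation.

Variable p a : nat.
Local Notation q := (p ^ a)%N.
Local Notation iterates G x := (fun i => iter i (semilinear_map q G) x).

Section Localized.

Variables (R : comNzRingType) (charRp : p \in [pchar R]) (e : nat).
Variables (G : 'M[R]_e.+1) (x : 'cV[R]_e.+1) (k : 'I_e.+1).

Hypothesis smaller_dim : forall (H : 'M[R]_e) (c : 'cV[R]_e),
  in_span (iterates H c) e (iterates H c e).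

Local Notation L := (proj_along k x).
Local Notation phi := (semilinear_map q G).
Local Notation v := (iterates G x).
Let H := L *m G *m col' k 1%:M.
Local Notation psi := (semilinear_map q H).
Let z j := L *m v j.
Let w := iterates H (z 1).

(** Apply [L] after [phi] to the decomposition of x_k y: the multiple of x contributes [z 1], and
    [H] is what [G] induces modulo x. *)
Lemma proj_semilinear_map y :
  x k 0 ^+ q *: (L *m phi y) = y k 0 ^+ q *: z 1 + psi (L *m y).
Proof.
have := congr1 (fun u => L *m phi u) (proj_along_decomp k x y).
rewrite (semilinear_mapD a charRp) !(semilinear_mapZ a charRp).
rewrite mulmxDr -!scalemxAr => ->; congr (_ + _).
rewrite /H !(semilinear_mapE a charRp) [in LHS]map_mxM !mulmxA.
congr (_ *m _ *m _).
by apply/matrixP => i j; rewrite !mxE rmorph_nat.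
Qed.

(** By induction: [psi] shifts each [w i] to [w i.+1], and the extra term produced by [phi] is a
    multiple of [z 1], which is [w 0]. *)
Lemma proj_iterate j :
  exists N, in_span w j (x k 0 ^+ N *: z j.+1 - w j).
Proof.
elim: j => [|j [N [c wE]]].
  by exists 0; rewrite expr0 scale1r subrr; apply: in_span0.
(* [psi] turns x_k^N into x_k^(Nq), and [proj_semilinear_map] costs a further x_k^q. *)
exists (N * q + q)%N.
have -> : x k 0 ^+ (N * q + q) *: z j.+2 - w j.+1 =
    psi (x k 0 ^+ N *: z j.+1 - w j)
    + (x k 0 ^+ (N * q) * v j.+1 k 0 ^+ q) *: w 0.
  rewrite (semilinear_mapB a charRp) (semilinear_mapZ a charRp) -exprM exprD.
  rewrite -scalerA proj_semilinear_map scalerDr scalerA [RHS]addrAC.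
  by congr (_ - _); rewrite addrC.
apply: in_spanD; last exact/in_spanZ/in_span_gen.
rewrite wE (semilinear_map_sum a charRp).
pose wS i := w i.+1; pose cq i := c i ^+ q.
by apply: (@in_span_sum _ _ w j.+1 j cq wS) => i ltij; apply: in_span_gen.
Qed.

(** The change of family in [proj_iterate] has coefficient 1 on [w j], so it is inverted without
    division. *)
Lemma iterate_in_proj j : in_span (fun i => z i.+1) j.+1 (w j).
Proof.
elim/ltn_ind: j => j IHj; have [N wE] := proj_iterate j.
rewrite -[w j](subKr (x k 0 ^+ N *: z j.+1)).
apply: in_spanB; first exact/in_spanZ/(@in_span_gen _ _ (fun i => z i.+1)).
apply: in_span_trans wE => i ltij.
exact/in_span_widen/(IHj i ltij)/leqW.
Qed.

(** The relation in dimension [e], carried from [w] to [z], lifts to a combination [s] of v_1, ...,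
    v_e that differs from x_k^N v_(e+1) by a vector killed by [L]; x_k times such a vector is a
    multiple of x. *)
Lemma localized_relation : exists N, in_span v e.+1 (x k 0 ^+ N *: v e.+1).
Proof.
have [N zE] := proj_iterate e.
have [c zc] : in_span (fun i => z i.+1) e (x k 0 ^+ N *: z e.+1).
  rewrite -[x k 0 ^+ N *: _](subrK (w e)).
  apply: (@in_span_trans _ _ _ w e); last exact/in_spanD/smaller_dim.
  by move=> i ltie; apply/in_span_widen/iterate_in_proj.
exists N.+1; rewrite exprS -scalerA.
set s : 'cV_e.+1 := \sum_(i < e) c i *: v i.+1.
have span_s : in_span v e.+1 s.
  apply: (@in_span_sum _ _ v _ _ c (fun i => v i.+1)) => i ltie.
  exact: in_span_gen.
have Ls : L *m (x k 0 ^+ N *: v e.+1 - s) = 0.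
  rewrite mulmxBr -scalemxAr zc mulmx_sumr -sumrB big1 // => i _.
  by rewrite -scalemxAr subrr.
rewrite -[x k 0 ^+ N *: _](subrK s) scalerDr.
apply: in_spanD; last exact: in_spanZ.
rewrite proj_along_decomp Ls mulmx0 addr0.
exact/in_spanZ/(@in_span_gen _ _ v _ 0).
Qed.

End Localized.

(** A determinant with nonzero image under [h] is nonzero, and the adjugate then forces the
    coefficients to vanish. *)
Lemma iterates_free (R S : idomainType) (h : {rmorphism R -> S}) (d : nat)
    (G : 'M[R]_d) (x : 'cV[R]_d) (c : 'I_d -> R) :
  \det (\matrix_(i < d, j < d) iterates (map_mx h G) (map_mx h x) j i 0) != 0 ->
  \sum_(i < d) c i *: iterates G x i = 0 -> forall i, c i = 0.
Proof.
set M := \matrix_(i, j) _ => detM sum0 i.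
pose N := \matrix_(i < d, j < d) iterates G x j i 0.
have detN : \det N != 0.
  apply: contraNneq detM => detN0.
  suff -> : M = map_mx h N by rewrite det_map_mx detN0 rmorph0.
  by apply/matrixP => r s; rewrite !mxE -map_iter_semilinear !mxE.
have Nc : N *m \col_j c j = 0.
  rewrite -sum0; apply/matrixP => r s; rewrite ord1 summxE !mxE.
  by apply: eq_bigr => j _; rewrite !mxE mulrC.
have /(congr1 (fun u : 'cV_d => u i 0)) := congr1 (mulmx (\adj N)) Nc.
rewrite mulmx0 mulmxA mul_adj_mx mul_scalar_mx !mxE => /eqP.
by rewrite mulf_eq0 (negPf detN) => /eqP.
Qed.

Definition shift_mx (R : pzRingType) d : 'M[R]_d :=
  \matrix_(i < d, j < d) (i == j.+1 :> nat)%:R.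

Lemma shift_iterates (R : comNzRingType) d (y : 'cV[R]_d.+1) n (j : 'I_d.+1) :
  (0 < q)%N ->
  iterates (shift_mx R d.+1) y n j 0 =
    if (n <= j)%N then y (inord (j - n)) 0 ^+ (q ^ n) else 0.
Proof.
move=> q0; elim: n j => [|n IHn] j; first by rewrite subn0 inord_val expr1.
rewrite iterS mxE; case: (posnP j) => [j0|j_gt0].
  by rewrite j0 big1 // => i _; rewrite !mxE j0 mul0r.
have lt_j1 : (j.-1 < d.+1)%N by rewrite (leq_ltn_trans (leq_pred j)).
rewrite (bigD1 (Ordinal lt_j1)) //= big1 => [|i ne_i]; last first.
  rewrite !mxE -[j : nat]prednK // eqSS eq_sym.
  by move: ne_i; rewrite -val_eqE /= => /negPf ->; rewrite mul0r.
rewrite addr0 !mxE /= prednK // eqxx mul1r /frob IHn /=.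
rewrite -(leq_add2r 1 n) !addn1 prednK //.
case: leqP => _; first by rewrite expr0n eqn0Ngt q0.
rewrite -exprM -expnSr; congr (y (inord _) 0 ^+ _).
by rewrite -[in RHS](prednK j_gt0) subSS.
Qed.

(** The matrix is lower triangular, with diagonal entries y_0^(q^i). *)
Lemma shift_iterates_det (R : idomainType) d (y : 'cV[R]_d.+1) : (0 < q)%N ->
  y ord0 0 != 0 ->
  \det (\matrix_(i < d.+1, j < d.+1) iterates (shift_mx R d.+1) y j i 0) != 0.
Proof.
move=> q0 y0; rewrite det_trig.
  apply/prodf_neq0 => i _; rewrite mxE shift_iterates // leqnn subnn expf_neq0 //.
  suff -> : inord 0 = ord0 :> 'I_d.+1 by [].
  by apply: val_inj; rewrite /= inordK.
by apply/is_trig_mxP => i j ltij; rewrite mxE shift_iterates // leqNgt ltij.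
Qed.

(** This is the regular sequence property used to remove denominators: a nonzero constant can be
    cancelled modulo a monic polynomial. *)
Lemma dvd_monic_mul (R : idomainType) (m u v : {poly R}) (c : R) :
  m \is monic -> c != 0 -> m * u = c *: v -> exists w, v = m * w.
Proof.
move=> mon_m c0 muv; have : m %| v by rewrite -(dvdpZr m v c0) -muv dvdp_mulr.
by case/(Pdiv.IdomainMonic.dvdpP mon_m) => w ->; exists w; rewrite mulrC.
Qed.

Theorem iterate_relation (R : idomainType) (charRp : p \in [pchar R]) d
    (G : 'M[R]_d) (x : 'cV[R]_d) :
  in_span (iterates G x) d (iterates G x d).
Proof.
have q0 : (0 < q)%N by rewrite expn_gt0 prime_gt0 // (pcharf_prime charRp).
(* The ring varies in the induction, because the hypothesis is applied over [Z]. *)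
elim: d => [|d IHd] in R charRp G x *.
  by rewrite [iter _ _ _]flatmx0; apply: in_span0.
case: d => [|d] in IHd G x *.
  exists (fun=> G 0 0 * x 0 0 ^+ q.-1); rewrite big_ord1.
  apply/matrixP => i j; rewrite !ord1 !mxE big_ord1 !mxE /frob.
  by rewrite -mulrA -exprSr prednK.
(* [Z] is R[s][t]: ['X%:P] is the inner variable s and ['X] the outer variable t. *)
pose Z := {poly {poly R}}.
pose t0 : {rmorphism Z -> {poly R}} := horner_eval (0 : {poly R}).
pose t1 : {rmorphism Z -> {poly R}} := horner_eval (1 : {poly R}).
pose s0 : {rmorphism {poly R} -> R} := horner_eval (0 : R).
pose C := @polyC {poly R} \o @polyC R.
pose k1 : 'I_d.+2 := lift ord0 ord0.
(* At s = t = 0, [y] and [H] are x and G; at t = 1, [H] is a shift, so that the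
   iterates of [y] form a triangular matrix with powers of x_0 + s on the
   diagonal. *)
pose y : 'cV[Z]_d.+2 :=
  map_mx C x + 'X%:P *: delta_mx ord0 0 + 'X *: delta_mx k1 0.
pose H : 'M[Z]_d.+2 := map_mx C G + 'X *: (shift_mx Z _ - map_mx C G).
have charZp : p \in [pchar Z] by rewrite !pchar_poly.
have y0E : y ord0 0 = ((x ord0 0)%:P + 'X)%:P.
  by rewrite !mxE eqxx /= mulr1 mulr0 addr0 rmorphD.
have y1E : y k1 0 = 'X + ((x k1 0)%:P)%:P.
  by rewrite !mxE eqxx /= mulr1 mulr0 addr0 addrC.
have t1H : map_mx t1 H = shift_mx _ _.
  rewrite map_mxD map_mxZ rmorphB /= /t1 /= horner_evalE hornerX scale1r.
  rewrite addrC subrK.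
  by apply/matrixP => i j; rewrite !mxE rmorph_nat.
have free c : \sum_(i < d.+2) c i *: iterates H y i = 0 -> forall i, c i = 0.
  apply: (@iterates_free _ _ t1); rewrite t1H shift_iterates_det //.
  rewrite mxE y0E /= horner_evalE hornerC addrC monic_neq0 //.
  by rewrite -[(x _ _)%:P]opprK -polyCN monicXsubC.
have [N0 [b0 r0]] := localized_relation charZp H y ord0 (IHd _ charZp).
have [N1 [b1 r1]] := localized_relation charZp H y k1 (IHd _ charZp).
set m0 := y ord0 0 ^+ N0 in r0; set m1 := y k1 0 ^+ N1 in r1.
(* Both sides are coefficients of [m0 * m1] times the last iterate, so freeness identifies them. *)
have eqb (i : 'I_d.+2) : m1 * b0 i = m0 * b1 i.
  apply/eqP; rewrite -subr_eq0; apply/eqP; move: i.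
  apply: free; under eq_bigr do rewrite scalerBl -!scalerA.
  by rewrite sumrB -!scaler_sumr -r0 -r1 !scalerA mulrC subrr.
have mon_m1 : m1 \is monic.
  by rewrite monic_exp // y1E -[(_)%:P%:P]opprK -polyCN monicXsubC.
(* [m1] is monic in t while [m0] is free of t, so [m1] divides [b1 i]. *)
have /fin_all_exists [c b1E] (i : 'I_d.+2) : exists w, b1 i = m1 * w.
  apply: (@dvd_monic_mul _ _ (b0 i) _ (((x ord0 0)%:P + 'X) ^+ N0)) => //.
    rewrite expf_neq0 // addrC monic_neq0 //.
    by rewrite -[(x _ _)%:P]opprK -polyCN monicXsubC.
  by rewrite eqb /m0 y0E -mul_polyC rmorphXn.
have rel : iterates H y d.+2 = \sum_(i < d.+2) c i *: iterates H y i.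
  have rel1 : m1 *: iterates H y d.+2 =
              m1 *: \sum_(i < d.+2) c i *: iterates H y i.
    by rewrite r1 scaler_sumr; apply: eq_bigr => i _; rewrite scalerA b1E.
  apply/matrixP => i j; apply: (mulfI (monic_neq0 mon_m1)).
  by have := congr1 (fun u : 'cV_d.+2 => u i j) rel1; rewrite mxE [in RHS]mxE.
pose f : {rmorphism Z -> R} := s0 \o t0.
have fC r : f (C r) = r by rewrite /f /= !horner_evalE !hornerC.
have fX : f 'X = 0 by rewrite /f /= !horner_evalE hornerX horner0.
have fXC : f 'X%:P = 0 by rewrite /f /= !horner_evalE hornerC hornerX.
have fH : map_mx f H = G.
  rewrite map_mxD map_mxZ fX scale0r addr0.
  by apply/matrixP => i j; rewrite !mxE; apply: fC.
have fy : map_mx f y = x.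
  rewrite !map_mxD !map_mxZ fX fXC.
  by rewrite !scale0r !addr0; apply/matrixP => i j; rewrite !mxE; apply: fC.
have fv n : map_mx f (iterates H y n) = iterates G x n.
  by rewrite map_iter_semilinear fH fy.
exists (fun i => f (c (inord i))); rewrite -fv rel map_mx_sum.
by apply: eq_bigr => i _; rewrite map_mxZ fv inord_val.
Qed.

End Relation.

(** * Matrices over a field with a prescribed cyclic vector *)

Lemma cyclic_vector_matrix (K : fieldType) p a (charKp : p \in [pchar K]) d
    (x : 'cV[K]_d.+1) : x != 0 ->
  exists G : 'M[K]_d.+1,
    \det (\matrix_(i < d.+1, j < d.+1)
            iter j (semilinear_map (p ^ a) G) x i 0) != 0.
Proof.
move=> x0; set sigma := frob_pow a charKp.
(* As [x^T] has rank one, it is [u] times the first row of its [row_ebase]; hence [E] is an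
   invertible matrix with first column x. *)
pose u := col_ebase x^T 0 0; pose E := u *: (row_ebase x^T)^T.
have rk : \rank x^T = 1 by rewrite rank_rV -(inj_eq trmx_inj) trmxK trmx0 x0.
have u0 : u != 0.
  have := col_ebase_unit x^T; rewrite unitmxE unitfE.
  by rewrite [col_ebase _]mx11_scalar det_scalar1.
have detE : \det E != 0.
  rewrite detZ mulf_neq0 ?expf_neq0 // det_tr -unitfE -unitmxE.
  exact: row_ebase_unit.
have xE : x = col ord0 E.
  have := mulmx_ebase x^T; rewrite rk => eb; apply/matrixP => i j.
  rewrite ord1 {j}; have <- : x^T 0 i = x i 0 by rewrite mxE.
  rewrite -[in LHS]eb [col_ebase _]mx11_scalar -mulmxA mul_scalar_mx !mxE.
  rewrite (bigD1 ord0) //= big1 => [|l ne_l].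
    by rewrite addr0 !mxE eqxx mul1r.
  rewrite !mxE; move: ne_l; rewrite -val_eqE /= eq_sym => /negPf ->.
  by rewrite mul0r.
have sE_unit : map_mx sigma E \in unitmx.
  by rewrite unitmxE det_map_mx unitfE fmorph_eq0.
(* Chosen so that the semilinear map sends each column of [E] to the next one. *)
pose G := E *m shift_mx K d.+1 *m invmx (map_mx sigma E); exists G.
have iterE j (ltjd : (j < d.+1)%N) :
    iter j (semilinear_map (p ^ a) G) x = col (Ordinal ltjd) E.
  elim: j ltjd => [|j IHj] ltjd.
    by rewrite [LHS]xE; congr (col _ E); apply: val_inj.
  rewrite iterS (IHj (ltnW ltjd)) (semilinear_mapE a charKp) map_col.
  rewrite [in LHS]colE mulmxA.
  rewrite mulmxKV // -mulmxA -colE [RHS]colE; congr (_ *m _).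
  by apply/matrixP => r s; rewrite !mxE ord1 eqxx andbT.
suff -> : \matrix_(i, j < d.+1) iter j (semilinear_map (p ^ a) G) x i 0 = E by [].
by apply/matrixP => i j; rewrite mxE iterE mxE; congr (E _ _); apply: val_inj.
Qed.

(** * Homogeneous components and degrees of the iterates *)

Lemma pihomogM n (R : nzRingType) (mf : measure n) e k (r s : {mpoly R[n]}) :
  s \is k.-homog for mf -> pihomog mf (e + k) (r * s) = pihomog mf e r * s.
Proof.
move=> hs.
(* The bound is enlarged so that [e] indexes a component of [r]; only that component, times [s],
   lands in degree [e + k]. *)
have bound : (mmeasure mf r <= mmeasure mf r + e.+1)%N by rewrite leq_addr.
have lt_e : (e < mmeasure mf r + e.+1)%N by rewrite addnS ltnS leq_addl.
rewrite [in LHS](pihomog_partitionE bound) mulr_suml linear_sum /=.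
have hom j : pihomog mf j r * s \is (j + k).-homog for mf.
  by rewrite dhomogM // pihomogP.
rewrite (bigD1 (Ordinal lt_e)) //= (pihomog_dE (hom _)) big1 ?addr0 // => j ne_j.
by rewrite (pihomog_ne0 _ (hom j)) // eqn_add2r.
Qed.

(** The geometric sum 1 + q + ... + q^(n-1). *)
Definition iterate_degree q n := iter n (fun m => 1 + m * q)%N 0.

Lemma iterate_degree_mono q m n : (0 < q)%N ->
  (m <= n)%N -> (iterate_degree q m <= iterate_degree q n)%N.
Proof.
move=> q0; apply: (homo_leq leqnn leq_trans) => i.
by rewrite /= (leq_trans (leq_pmulr _ q0)) // leq_addl.
Qed.

Lemma generic_iterate_homog (K : fieldType) q d (x : 'cV[K]_d) n i :
  iter n (semilinear_map q (generic_mx K d)) (const_vec x) i 0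
    \is (iterate_degree q n).-homog.
Proof.
elim: n i => [|n IHn] i.
  by rewrite mxE -[_%:MP]mulr1 mul_mpolyC dhomogZ ?dhomog1.
rewrite iterS mxE rpred_sum // => j _; rewrite !mxE dhomogM ?dhomogMn //.
by rewrite dhomogX /= mdeg1.
Qed.

Theorem theorem1p2p1 (K : fieldType) (p a : nat) (hp : p \in [pchar K])
    (ha : (1 <= a)%N)
    (Fq : finFieldType) (cardFq : #|Fq| = (p ^ a)%N)
    (iota : {rmorphism Fq -> K})
    (d : nat) (hd : (1 <= d)%N) (x : 'cV[K]_d) (hx : x != 0) :
  let phi := semilinear_map (p ^ a) (generic_mx K d) in
  let x' := const_vec x in
  exists P : {ffun 'I_d -> {mpoly K[d * d]}},
    unique (fun Q : {ffun 'I_d -> {mpoly K[d * d]}} =>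
              iter d phi x' = \sum_(i < d) Q i *: iter i phi x') P
    /\ forall i : 'I_d, exists n : nat, P i \is n.-homog.
Proof.
case: d hd x hx => // d _ x hx phi x'; set q := (p ^ a)%N in phi *.
have q0 : (0 < q)%N by rewrite expn_gt0 prime_gt0 // (pcharf_prime hp).
have charAp : p \in [pchar {mpoly K[d.+1 * d.+1]}].
  exact: (rmorph_pchar (@mpolyC (d.+1 * d.+1) K)).
have [c rel] := iterate_relation a charAp (generic_mx K d.+1) x'.
(* The degree that makes the i-th term as homogeneous as the left side; by monotonicity the
   subtraction is not truncated. *)
pose deg i := (iterate_degree q d.+1 - iterate_degree q i)%N.
pose P := [ffun i : 'I_d.+1 => pihomog mdeg (deg i) (c i)].
have relP : iter d.+1 phi x' = \sum_(i < d.+1) P i *: iter i phi x'.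
  apply/matrixP => r s; rewrite ord1.
  rewrite -(pihomog_dE (generic_iterate_homog q x d.+1 r)) [iter d.+1 _ _]rel.
  rewrite !summxE linear_sum; apply: eq_bigr => i _; rewrite !mxE ffunE /=.
  rewrite -(pihomogM _ _ (generic_iterate_homog q x i r)) subnK //.
  exact/iterate_degree_mono/ltnW.
exists P; split; last by move=> i; exists (deg i); rewrite ffunE pihomogP.
split=> // Q relQ; apply/ffunP => i; apply/eqP; rewrite -subr_eq0; apply/eqP.
move: i.
(* Evaluating the generic matrix at [G0] shows that the iterates are free, so the two coefficient
   families agree. *)
have [G0 detG0] := cyclic_vector_matrix a hp hx.
pose h : {rmorphism {mpoly K[d.+1 * d.+1]} -> K} := meval (fun k => mxvec G0 0 k).
apply: (@iterates_free p a _ _ h _ (generic_mx K d.+1) x').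
  have -> : map_mx h x' = x by apply/matrixP => i j; rewrite !mxE /h /= mevalC.
  suff -> : map_mx h (generic_mx K d.+1) = G0 by [].
  by apply/matrixP => i j; rewrite !mxE /h /= mevalXU mxvecE.
by under eq_bigr do rewrite scalerBl; rewrite sumrB -relP -relQ subrr.
Qed.
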